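(* For every positive integer $n$, \[ \overline{p}_o(n)=\sum_{k=0}^{\infty}P_2\!\left(n-\frac{k(k+1)}{2}\right). \]
   Context: $P_2(n)$ denotes the number of partitions of $n$ into parts not congruent to $2 \pmod 4$; $\sum_{n\ge0}P_2(n)q^n=\frac{(q^2;q^4)_\infty}{(q;q)_\infty}$, where $(a;q)_\infty=\prod_{k\ge1}(1-aq^{k-1})$. $\overline{p}_o(n)$ is the number of overpartitions of $n$ into odd parts (partitions into odd parts in which the first occurrence of each part size may be overlined), with $\sum_{n\ge0}\overline{p}_o(n)q^n=\frac{(-q;q^2)_\infty}{(q;q^2)_\infty}$. Convention: $P_2(x)=0$ whenever $x$ is not a nonnegative integer. *)

(* Defs.v *)
From mathcomp Require Import all_boot all_order all_algebra.
From mathcomp Require Import all_classical all_reals all_analysis.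

Set Implicit Arguments.
Unset Strict Implicit.
Unset Printing Implicit Defensive.

Definition is_partition (n : nat) (s : seq nat) : bool :=
  [&& sorted geq s, 0 \notin s & sumn s == n].

(* A pair (a, b) is a part of size a, overlined iff b = true. *)
Definition is_overpartition (n : nat) (s : seq (nat * bool)) : bool :=
  is_partition n (unzip1 s) &&
  [forall i : 'I_(size s),
     (nth (0, false) s i).2 ==>
     ((nth (0, false) s i).1 \notin take i (unzip1 s))].

Lemma is_partition_bounded n s :
  is_partition n s -> size s <= n /\ all (fun a => a < n.+1) s.
Proof.
case/and3P=> _ + /eqP <- {n}.
elim: s => //= a s IHs; rewrite inE negb_or eq_sym -lt0n => /andP[a_gt0 s0].
have [le_s /allP lt_s] := IHs s0; split; first exact: leq_add a_gt0 le_s.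
rewrite ltnS leq_addr; apply/allP=> b /lt_s lt_b.
by rewrite /= ltnS (leq_trans _ (leq_addl _ _)).
Qed.

(* By is_partition_bounded, the bounds by n on the length and on the parts
   exclude no partition of n; they only make the set finite. *)
Definition P2_nat (n : nat) : nat :=
  #|[set s : n.-bseq 'I_n.+1 |
      is_partition n (map val s) &&
      all (fun a => a %% 4 != 2) (map val s)]|.

Definition P2 (x : int) : nat := if x is Posz n then P2_nat n else 0.

Definition odd_overpartitions (n : nat) : nat :=
  #|[set s : n.-bseq ('I_n.+1 * bool) |
      let t := [seq (val x.1, x.2) | x <- s] in
      is_overpartition n t && all odd (unzip1 t)]|.

(* Main.v *)
Require Import Defs.
From mathcomp Require Import all_boot all_order all_algebra.
From mathcomp Require Import all_classical all_reals all_analysis.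
From mathcomp Require Import ring zify.

(* Listing an overpartition by weakly decreasing parts and splitting on its
   first entry gives a recursion in the bound on the parts, hence both counts
   have the expected product generating functions, as polynomials modulo
   q^(n+1). The theorem then follows from Gauss's identity
     sum_k q^(k(k+1)/2) = (q^2; q^2)_oo / (q; q^2)_oo,
   proved through Shanks' finite version of it, together with
     (-q; q^2)_oo (q; q^2)_oo = (q^2; q^4)_oo. *)

Set Implicit Arguments.
Unset Strict Implicit.
Unset Printing Implicit Defensive.

Import GRing.Theory Num.Theory.

(** * Polynomials modulo a power of the indeterminate *)

Section TruncatedEquality.
Local Open Scope ring_scope.
Variables (R : comNzRingType) (N : nat).
Implicit Types p q r : {poly R}.

Definition eq_trunc p q := take_poly N p = take_poly N q.

Lemma eq_truncP p q : eq_trunc p q <-> forall i, (i < N)%N -> p`_i = q`_i.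
Proof.
split=> [pq i iN | pq].
  by have := congr1 (coefp i) pq; rewrite /= !coef_take_poly iN.
by apply/polyP => i; rewrite !coef_take_poly; case: ifP => // /pq.
Qed.

Lemma eq_trunc_trans q p r : eq_trunc p q -> eq_trunc q r -> eq_trunc p r.
Proof. exact: etrans. Qed.

Lemma eq_truncM p p' q q' :
  eq_trunc p p' -> eq_trunc q q' -> eq_trunc (p * q) (p' * q').
Proof.
move=> /eq_truncP pp' /eq_truncP qq'; apply/eq_truncP => i iN.
rewrite !coefM; apply: eq_bigr => j _.
by rewrite pp' ?qq' // (leq_ltn_trans _ iN) ?leq_subr // -ltnS.
Qed.

Lemma eq_truncMl r p q : eq_trunc p q -> eq_trunc (r * p) (r * q).
Proof. by move=> pq; exact: eq_truncM. Qed.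

Lemma eq_trunc_prod (I : Type) (s : seq I) (P : pred I) (F G : I -> {poly R}) :
  (forall i, P i -> eq_trunc (F i) (G i)) ->
  eq_trunc (\prod_(i <- s | P i) F i) (\prod_(i <- s | P i) G i).
Proof. by move=> FG; apply: big_ind2 => //; exact: eq_truncM. Qed.

Lemma eq_trunc_Xn m p : (N <= m)%N -> eq_trunc ('X^m * p) 0.
Proof.
by move=> Nm; apply/eq_truncP => i iN; rewrite coefXnM coef0 (leq_trans iN Nm).
Qed.

Lemma eq_trunc_1BXn m : (N <= m)%N -> eq_trunc (1 - 'X^m) 1.
Proof.
move=> Nm; apply/eq_truncP => i iN.
by rewrite coefB coefXn ltn_eqF ?subr0 // (leq_trans iN).
Qed.

(** Since [d] has constant term 1, the coefficient of degree [i] in [(p - q) * d] is that of [p - q]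
    plus multiples of lower ones, which vanish by induction. This cancellation replaces division by
    the products. *)
Lemma eq_trunc_mulI p q (d : {poly R}) :
  d`_0 = 1 -> eq_trunc (p * d) (q * d) -> eq_trunc p q.
Proof.
move=> d0 /eq_truncP pq.
suff H: forall i, (i < N)%N -> (p - q)`_i = 0.
  by apply/eq_truncP => i /H /eqP; rewrite coefB subr_eq0 => /eqP.
elim/ltn_ind => i IH iN.
have : ((p - q) * d)`_i = 0 by rewrite mulrBl coefB pq // subrr.
rewrite coefMr big_ord_recl d0 subn0 mulr1 big1 ?addr0 // => j _.
by have ji := ltn_ord j; rewrite IH ?mul0r //= /bump /=; lia.
Qed.

End TruncatedEquality.

(** * Shanks' finite version of Gauss's identity *)

Section Gauss.
Local Open Scope ring_scope.
Variables (R : comNzRingType) (x : R).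

(** For s <= n and q = [x] this is q^(s(2n+1)) (q;q^2)_s (q^2;q^2)_n / (q^2;q^2)_s; starting the
    first product at [s] avoids the quotient. *)
Definition shanks_term n s : R := x ^+ (s * (2 * n).+1) *
  (\prod_(s <= j < n) (1 - x ^+ (2 * j).+2)) *
  (\prod_(0 <= j < s) (1 - x ^+ (2 * j).+1)).

(* Shanks' finite form of Gauss's identity, cleared of denominators. The step
   from n to n.+1 telescopes in s. *)
Lemma shanks_identity n :
  (\sum_(0 <= k < 2 * n) x ^+ (k * k.+1 %/ 2)) *
    \prod_(0 <= j < n) (1 - x ^+ (2 * j).+1) =
  \sum_(0 <= s < n) shanks_term n s.
Proof.
elim: n => [|n IHn]; first by rewrite !big_geq // mul0r.
(* The correction is G(s+1) - G(s) with G(s) = [shanks_term n s * (1 - x ^+ (2 * s))]. *)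
have HS s : (0 <= s < n)%N -> shanks_term n.+1 s =
    (1 - x ^+ (2 * n).+1) * shanks_term n s +
    (shanks_term n s.+1 * (1 - x ^+ (2 * s.+1)) - shanks_term n s * (1 - x ^+ (2 * s))).
  move=> /= sn; rewrite /shanks_term big_nat_recr /=; last exact: ltnW.
  rewrite (big_ltn sn) [\prod_(0 <= j < s.+1) _]big_nat_recr //=.
  set a := \prod_(_ <= j < n) _; set b := \prod_(_ <= j < s) _.
  have -> : (s * (2 * n.+1).+1 = s * (2 * n).+1 + 2 * s)%N by lia.
  have -> : ((2 * s).+2 = 2 * s.+1)%N by lia.
  have -> : (s.+1 * (2 * n).+1 = (2 * n).+1 + s * (2 * n).+1)%N by lia.
  have -> : ((2 * n).+2 = (2 * n).+1 + 1)%N by lia.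
  have -> : ((2 * s).+1 = 2 * s + 1)%N by lia.
  have -> : (2 * s.+1 = 2 * s + 2)%N by lia.
  rewrite !exprD; move: (x ^+ (_ * _)) (x ^+ (2 * s)) (x ^+ (2 * n).+1) => u v w.
  by ring.
rewrite [RHS]big_nat_recr //= (eq_big_nat _ _ HS) big_split /= -mulr_sumr -IHn.
(* G(0) vanishes through its factor 1 - x^0. G(n) and the new term s = n must account for the
   triangular numbers with k = 2n and k = 2n+1. *)
rewrite telescope_sumr // [(2 * 0)%N]muln0 expr0 subrr mulr0 subr0.
have -> : (2 * n.+1 = (2 * n).+2)%N by lia.
rewrite !(@big_nat_recr _ _ _ (2 * n).+1, @big_nat_recr _ _ _ (2 * n)) //=.
rewrite [\prod_(0 <= j < n.+1) _]big_nat_recr //= /shanks_term big_nat1 (big_geq (leqnn n)) mulr1.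
have -> : ((2 * n * (2 * n).+1) %/ 2 = n * (2 * n).+1)%N.
  by rewrite -mulnA mulKn.
have -> : (((2 * n).+1 * (2 * n).+2) %/ 2 = (2 * n).+1 + n * (2 * n).+1)%N.
  have -> : ((2 * n).+1 * (2 * n).+2 = 2 * ((2 * n).+1 + n * (2 * n).+1))%N by lia.
  by rewrite mulKn.
have -> : (n * (2 * n.+1).+1 = 2 * n + n * (2 * n).+1)%N by lia.
have -> : ((2 * n).+2 = 2 * n + 2)%N by lia.
have -> : ((2 * n).+1 = 2 * n + 1)%N by lia.
rewrite !exprD; move: (x ^+ (2 * n)) (x ^+ (n * _)) => u v.
move: (\sum_(_ <= _ < _) _) (\prod_(_ <= _ < _) _) => a b.
by ring.
Qed.

End Gauss.


(** * Overlining as a condition on adjacent parts *)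

Definition overline_rel (x y : nat * bool) :=
  (y.1 <= x.1) && (y.2 ==> (y.1 != x.1)).

Lemma overline_rel_trans : transitive overline_rel.
Proof.
move=> [b b'] [a a'] [c c']; rewrite /overline_rel /=.
by case: b' c' => [] [] /=; lia.
Qed.

Lemma path_overline_rel a b s : path overline_rel (a, b) s = path overline_rel (a, false) s.
Proof. by case: s. Qed.

(** Equal parts are adjacent in a weakly decreasing list, so an overlined entry is a first
    occurrence once it differs from its predecessor. Transitivity extends the adjacent condition to
    all pairs. *)
Lemma sorted_overline_rel s :
  sorted overline_rel s =
  sorted geq (unzip1 s) &&
  [forall i : 'I_(size s),
     (nth (0, false) s i).2 ==>
     ((nth (0, false) s i).1 \notin take i (unzip1 s))].
Proof.
have geq_trans : transitive geq by move=> y x z xy yz; exact: leq_trans yz xy.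
rewrite !sorted_pairwise //; last exact: overline_rel_trans.
rewrite pairwise_map -[RHS]/(_ && _).
have -> : pairwise overline_rel s =
    pairwise (relpre fst geq) s &&
    pairwise [rel x y | y.2 ==> (y.1 != x.1)] s.
  by rewrite -pairwise_relI; apply: eq_pairwise.
congr (_ && _); apply/(pairwiseP (0, false))/forallP => /=.
- move=> H i; apply/implyP => oi; apply/negP.
  move=> /(nthP 0) [j]; rewrite size_take size_map ltn_ord => ji.
  rewrite nth_take // (nth_map (0, false)) ?(ltn_trans ji) // => eij.
  have := H j i; rewrite !inE ltn_ord (ltn_trans ji) // => /(_ isT isT ji).
  by rewrite oi eij eqxx.
- move=> H i j; rewrite !inE => si sj ij; have := H (Ordinal sj) => /=.
  case: (nth _ s j).2 => //=; apply: contra => /eqP ->.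
  rewrite -(nth_map _ 0 fst) // -(nth_take 0 ij) mem_nth //.
  by rewrite size_take size_map sj.
Qed.

(** * Counting overpartitions whose entries satisfy a predicate *)

Section CountingOverpartitions.
Variable A : pred (nat * bool).
Hypothesis A0 : forall b, ~~ A (0, b).

(* The bound (m, false) at the head of the path allows only non-overlined
   copies of the part m. *)
Definition over_chain m n (s : seq (nat * bool)) :=
  [&& path overline_rel (m, false) s, all A s & sumn (unzip1 s) == n].

Definition forget_bounds N (s : N.-bseq ('I_N.+1 * bool)) : seq (nat * bool) :=
  [seq (val x.1, x.2) | x <- s].

(** Fixing [N] gives one duplicate-free ambient list, in which counts for varying [m] and [n] can be
    compared; it misses no chain when [n <= N]. *)
Definition over_count N m n := count (over_chain m n) (codom (@forget_bounds N)).

Lemma forget_bounds_inj N : injective (@forget_bounds N).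
Proof.
move=> s t /inj_map st; apply: val_inj; apply: st => -[a b] [c d] [ac bd].
by congr (_, _) => //; exact: val_inj.
Qed.

Lemma uniq_forget_bounds N : uniq (codom (@forget_bounds N)).
Proof. by rewrite map_inj_uniq ?enum_uniq //; exact: forget_bounds_inj. Qed.

Lemma mem_forget_bounds N s :
  size s <= N -> all (fun a => a < N.+1) (unzip1 s) ->
  s \in codom (@forget_bounds N).
Proof.
move=> sN /allP aN.
have tN : size [seq (inord x.1 : 'I_N.+1, x.2) | x <- s] <= N by rewrite size_map.
suff -> : s = forget_bounds (Bseq tN) by exact: codom_f.
rewrite /forget_bounds /= -map_comp map_id_in // => -[a b] sab /=.
by rewrite inordK // aN //; apply/mapP; exists (a, b).
Qed.

Lemma all_pos s : all A s -> 0 \notin unzip1 s.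
Proof.
move=> /allP As; apply/mapP => -[[a b] /As Aab /= a0].
by move: Aab; rewrite -a0 (negbTE (A0 b)).
Qed.

Lemma over_chain_bounded N m n s :
  n <= N -> over_chain m n s -> s \in codom (@forget_bounds N).
Proof.
move=> nN /and3P[/path_sorted + As sn].
rewrite sorted_overline_rel => /andP[ss _].
have [sz /allP lt] : size (unzip1 s) <= n /\ all (fun a => a < n.+1) (unzip1 s).
  by apply: is_partition_bounded; rewrite /is_partition ss all_pos.
apply: mem_forget_bounds; first by rewrite -(size_map fst) (leq_trans sz).
by apply/allP => a /lt /=; lia.
Qed.

(** Removing the head is a bijection, and the mark on [h] does not constrain what follows, so only
    [h.1] remains as a bound. *)
Lemma over_count_head N m n h : n <= N ->
  count [pred s | over_chain m n s && (ohead s == Some h)]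
    (codom (@forget_bounds N)) =
  [&& overline_rel (m, false) h, A h & h.1 <= n] * over_count N h.1 (n - h.1).
Proof.
move=> nN; set S := codom _.
have headE s : over_chain m n (h :: s) =
    [&& overline_rel (m, false) h, A h & h.1 <= n] && over_chain h.1 (n - h.1) s.
  case: h => a b; rewrite /over_chain /= path_overline_rel.
  have -> : (a + sumn (unzip1 s) == n) = (a <= n) && (sumn (unzip1 s) == n - a).
    by lia.
  by rewrite -!andbA; do !bool_congr.
case Ch: [&& _, _ & _]; last first.
  rewrite mul0n; apply/eqP; rewrite eqn0Ngt -has_count; apply/hasPn => -[|x s] _ /=.
    by rewrite andbF.
  by apply/negP => /andP[+ /eqP[xh]]; rewrite xh headE Ch.
rewrite mul1n /over_count -!size_filter -[RHS](size_map (cons h)).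
apply: perm_size; apply: uniq_perm.
- by rewrite filter_uniq ?uniq_forget_bounds.
- by rewrite map_inj_uniq ?filter_uniq ?uniq_forget_bounds // => x y [].
move=> s; rewrite mem_filter; apply/andP/mapP.
- case: s => [[/=]|x s]; first by rewrite andbF.
  move=> /= [/andP[+ /eqP[xh]] _]; rewrite {x}xh headE Ch /= => hs.
  exists s => //.
  by rewrite mem_filter hs (over_chain_bounded _ hs) // (leq_trans (leq_subr _ _)).
- move=> [t]; rewrite mem_filter => /andP[ht tS] ->.
  have hh : over_chain m n (h :: t) by rewrite headE Ch.
  by rewrite /= hh eqxx (over_chain_bounded _ hh).
Qed.

(** The chains gained in passing from bound [m] to [m.+1] start with a plain [m.+1] or an overlined
    [m]; an overlined [m.+1] is still excluded. *)
Lemma over_countS N m n : n <= N ->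
  over_count N m.+1 n =
    over_count N m n +
    [&& A (m.+1, false) & m.+1 <= n] * over_count N m.+1 (n - m.+1) +
    [&& A (m, true) & m <= n] * over_count N m (n - m).
Proof.
move=> nN.
have H1 := over_count_head m.+1 (m.+1, false) nN.
have H2 := over_count_head m.+1 (m, true) nN.
rewrite /overline_rel /= leqnn /= in H1; rewrite /overline_rel /= leqnSn ltn_eqF //= in H2.
rewrite -{}H1 -{}H2 /over_count.
elim: (codom _) => //= s l ->.
suff -> : (over_chain m.+1 n s : nat) = over_chain m n s +
  (over_chain m.+1 n s && (ohead s == Some (m.+1, false))) +
  (over_chain m.+1 n s && (ohead s == Some (m, true))) by lia.
case: s => [|[c d] s]; first by rewrite /= !andbF !addn0.
rewrite /over_chain /= !(inj_eq Some_inj) !xpair_eqE.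
case: (path _ _ s); rewrite ?andbF //= !andbT.
case: (_ && (_ == n)); rewrite ?andbF //= !andbT.
by rewrite /overline_rel /=; case: d => /=; lia.
Qed.

Lemma over_count0 N n : over_count N 0 n = (n == 0).
Proof.
rewrite /over_count (@eq_count _ _ [pred s | (n == 0) && (s == [::])]); last first.
  move=> [|[[|a] b] s]; rewrite /over_chain /= ?(negbTE (A0 b)) ?andbF //=.
  by rewrite andbT eq_sym.
case: (n == 0); last by rewrite (@eq_count _ _ pred0) ?count_pred0.
rewrite (@eq_count _ _ (pred1 [::])) // count_uniq_mem ?uniq_forget_bounds //.
by rewrite mem_forget_bounds.
Qed.

Local Open Scope ring_scope.

Definition over_series N m : {poly int} := \poly_(i < N.+1) (over_count N m i)%:R.

(** The term of [over_countS] that keeps the bound [m.+1] moves to the left. The multiplicity [*+ A]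
    turns the factor of a forbidden entry into 1. *)
Lemma over_seriesS N m : eq_trunc N.+1
  (over_series N m.+1 * (1 - 'X^(m.+1) *+ A (m.+1, false)))
  (over_series N m * (1 + 'X^m *+ A (m, true))).
Proof.
apply/eq_truncP => i iN; rewrite mulrBr mulrDr !mulr1 !mulrnAr coefB coefD !coefMn.
rewrite ![_ * 'X^_]mulrC !coefXnM !coef_poly iN.
rewrite !(leq_ltn_trans (leq_subr _ _) iN) over_countS //.
rewrite !natrD !natrM ![(i < _)%N]ltnNge !if_neg.
case: (A (m.+1, false)); case: (A (m, true)); case: (m.+1 <= i)%N; case: (m <= i)%N;
  rewrite /= ?mulr1n ?mulr0n; ring.
Qed.

Lemma over_series_prod N m : eq_trunc N.+1
  (over_series N m * \prod_(0 <= i < m) (1 - 'X^(i.+1) *+ A (i.+1, false)))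
  (\prod_(0 <= i < m) (1 + 'X^i *+ A (i, true))).
Proof.
elim: m => [|m IH].
  rewrite !big_geq // mulr1; apply/eq_truncP => i iN.
  by rewrite coef_poly iN coef1 over_count0; case: eqP.
rewrite !big_nat_recr //= mulrCA.
apply: eq_trunc_trans (eq_truncMl _ (over_seriesS N m)) _.
by rewrite mulrA; apply: eq_truncM; rewrite // mulrC.
Qed.

End CountingOverpartitions.


(** * Both counts as instances of the general one *)

Definition odd_part (x : nat * bool) := odd x.1.

(** Ordinary partitions are overpartitions without marks. Positivity is explicit because 0 is not 2
    modulo 4. *)
Definition P2_part (x : nat * bool) := [&& ~~ x.2, 0 < x.1 & x.1 %% 4 != 2].

(** The bound is strict because a head bound equal to [n] would exclude an overlined part [n]. *)
Lemma odd_overpartitionsE n m : n < m ->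
  odd_overpartitions n = over_count odd_part n m n.
Proof.
move=> nm; rewrite /over_count count_map enumT.
rewrite /odd_overpartitions cardE size_filter; apply: eq_count => s /=.
rewrite inE.
rewrite -/(forget_bounds s); move: (forget_bounds s) => {}s.
rewrite /is_overpartition /over_chain (path_sortedE overline_rel_trans) sorted_overline_rel.
rewrite all_map (eq_all (_ : preim fst odd =1 odd_part)) //.
case As : (all odd_part s); rewrite ?andbF //= andbT.
have s0 : 0 \notin unzip1 s by exact: all_pos As.
case ps : (is_partition n (unzip1 s)); last first.
  apply/esym/negP => /andP[/and3P[_ ss _] sn].
  by rewrite /is_partition ss s0 sn in ps.
move: (ps); rewrite /is_partition => /and3P[-> _ ->]; rewrite /= andbT.
suff -> : all (overline_rel (m, false)) s by [].
have [_ /allP lt] := is_partition_bounded ps.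
apply/allP => x xs; have /= := lt _ (map_f fst xs).
by rewrite /overline_rel /=; lia.
Qed.

(** Marking every part [false] is the bijection. [N] may exceed [n] because the final convolution
    reads coefficients below the truncation degree. *)
Lemma P2_natE N n m : n < m -> n <= N ->
  P2_nat n = over_count P2_part N m n.
Proof.
move=> nm nN; rewrite /over_count -size_filter /P2_nat cardE.
pose f (s : n.-bseq 'I_n.+1) : seq (nat * bool) := [seq (val x, false) | x <- s].
have f_inj : injective f.
  move=> s t /inj_map st; apply: val_inj; apply: st => a b [ab].
  exact: val_inj.
have P20 b : ~~ P2_part (0, b) by rewrite /P2_part andbF.
rewrite -(size_map f); apply: perm_size; apply: uniq_perm.
- by rewrite map_inj_uniq ?enum_uniq.
- by rewrite filter_uniq ?uniq_forget_bounds.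
have unf (u : seq nat) : unzip1 [seq (a, false) | a <- u] = u.
  by rewrite /unzip1 -map_comp map_id.
have srt (u : seq nat) :
    sorted overline_rel [seq (a, false) | a <- u] = sorted geq u.
  rewrite sorted_map; apply: eq_sorted => a b.
  by rewrite /overline_rel /= andbT.
move=> s; apply/mapP/idP.
- move=> [t]; rewrite mem_enum inE => /andP[pt /allP t2] ->.
  have -> : f t = [seq (a, false) | a <- map val t] by rewrite -map_comp.
  move: (map val t) pt t2 => u pu u2.
  suff ch : over_chain P2_part m n [seq (a, false) | a <- u].
    by rewrite mem_filter ch (over_chain_bounded P20 _ ch).
  have [_ /allP lt] := is_partition_bounded pu.
  case/and3P: pu => su u0 un.
  rewrite /over_chain (path_sortedE overline_rel_trans) srt su unf un !andbT.
  apply/andP; split; apply/allP => _ /mapP[a au ->].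
    by have := lt _ au; rewrite /overline_rel /=; lia.
  rewrite /P2_part /= u2 // andbT lt0n.
  by apply: contra u0 => /eqP <-.
- rewrite mem_filter => /andP[/and3P[/path_sorted ss As sn] _].
  have sE : s = [seq (a, false) | a <- unzip1 s].
    rewrite -map_comp map_id_in // => -[a b] /(allP As) /=.
    by rewrite /P2_part; case: b.
  have ps : is_partition n (unzip1 s).
    by rewrite /is_partition -srt -sE ss (all_pos P20).
  have [sz /allP lt] := is_partition_bounded ps.
  have tz : size [seq (inord a : 'I_n.+1) | a <- unzip1 s] <= n by rewrite size_map.
  have tE : map val (Bseq tz) = unzip1 s.
    by rewrite /= -map_comp map_id_in // => a /lt /= an; rewrite inordK.
  exists (Bseq tz).
    rewrite mem_enum inE tE ps /=; apply/allP => a /mapP[x /(allP As) + ->].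
    by case/and3P.
  by rewrite {1}sE -[in LHS]tE -map_comp.
Qed.

(** * Product formulas and comparison of coefficients *)

Section Products.
Local Open Scope ring_scope.

Lemma prod_nat_double (R : comNzRingType) (F : nat -> R) n :
  \prod_(0 <= i < 2 * n) F i =
  \prod_(0 <= i < n) F (2 * i)%N * \prod_(0 <= i < n) F (2 * i).+1.
Proof.
elim: n => [|n IH]; first by rewrite !big_geq // mulr1.
have -> : (2 * n.+1 = (2 * n).+2)%N by lia.
by rewrite !big_nat_recr //= IH; ring.
Qed.

Lemma coef0_prod (R : comNzRingType) (I : Type) (s : seq I) (P : pred I)
    (F : I -> {poly R}) :
  (forall i, P i -> (F i)`_0 = 1) -> (\prod_(i <- s | P i) F i)`_0 = 1.
Proof.
move=> F1; elim/big_rec: _ => [|i p Pi p1]; first by rewrite coef1.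
by rewrite coef0M F1 // p1 mulr1.
Qed.

Definition odd_prod M : {poly int} := \prod_(0 <= j < M) (1 - 'X^((2 * j).+1)).

Definition even_prod M : {poly int} := \prod_(0 <= j < M) (1 - 'X^((2 * j).+2)).

(** A truncation of (q;q)_oo / (q^2;q^4)_oo. *)
Definition P2_prod M : {poly int} :=
  \prod_(0 <= i < 2 * M) (1 - 'X^(i.+1) *+ P2_part (i.+1, false)).

Lemma odd_overpartitions_series N M : eq_trunc N.+1
  (over_series odd_part N (2 * M) * odd_prod M)
  (\prod_(0 <= j < M) (1 + 'X^((2 * j).+1))).
Proof.
have := @over_series_prod odd_part (fun=> isT) N (2 * M).
rewrite !prod_nat_double /odd_part /=.
(* Index [i] stands for the plain part [i.+1] but the overlined part [i], so odd parts sit at even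
   indices on the left and at odd indices on the right. *)
under eq_bigr do rewrite mul2n odd_double mulr1n -mul2n.
under [X in _ * (_ * X)]eq_bigr do rewrite mul2n odd_double mulr0n subr0.
under [X in eq_trunc _ _ (X * _)]eq_bigr do rewrite mul2n odd_double mulr0n addr0.
under [X in eq_trunc _ _ (_ * X)]eq_bigr do rewrite mul2n odd_double mulr1n -mul2n.
by rewrite !big1_eq mul1r mulr1.
Qed.

Lemma P2_series N M :
  eq_trunc N.+1 (over_series P2_part N (2 * M) * P2_prod M) 1.
Proof.
have P20 b : ~~ P2_part (0%N, b) by rewrite /P2_part andbF.
have := over_series_prod P20 N (2 * M).
under [X in eq_trunc _ _ X]eq_bigr do rewrite mulr0n addr0.
by rewrite big1_eq.
Qed.

(** In Shanks' identity each term with s > 0 is divisible by q^(2M+1), so only s = 0 survives. *)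
Lemma triangular_series N M : (N < 2 * M)%N -> eq_trunc N.+1
  ((\sum_(0 <= k < 2 * M) 'X^(k * k.+1 %/ 2)) * odd_prod M) (even_prod M).
Proof.
case: M => [|M] NM; first by rewrite ltn0 in NM.
rewrite shanks_identity big_nat_recl //; apply/eq_truncP => i iN.
rewrite coefD coef_sum big1_seq ?addr0.
  by rewrite /shanks_term mul0n expr0 mul1r (big_geq (leqnn 0)) mulr1.
move=> s _; rewrite /shanks_term -mulrA.
set p := (X in _ * X); have Ns : (N.+1 <= s.+1 * (2 * M.+1).+1)%N by lia.
by have /eq_truncP/(_ i iN) -> := eq_trunc_Xn p Ns; rewrite coef0.
Qed.

Lemma prod_2mod4 N M : (N <= 2 * M)%N -> eq_trunc N.+1
  (\prod_(0 <= j < M) (1 - 'X^((4 * j).+2)))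
  (\prod_(0 <= i < 2 * M) (1 - 'X^(i.+1) *+ (i.+1 %% 4 == 2)%N) : {poly int}).
Proof.
move=> NM; set F := fun i => (1 - 'X^(i.+1) *+ (i.+1 %% 4 == 2)%N : {poly int}).
(* Two splittings by parity isolate the indices i = 4j+1. The factors with i >= 2M are then 1 modulo
   q^(N+1). *)
have -> : \prod_(0 <= j < M) (1 - 'X^((4 * j).+2)) = \prod_(0 <= i < 2 * (2 * M)) F i.
  rewrite prod_nat_double [X in X * _]big1 => [|i _]; last first.
    by rewrite /F (_ : _ == _ = false) ?mulr0n ?subr0 //; lia.
  rewrite mul1r prod_nat_double [X in _ * X]big1 => [|i _]; last first.
    by rewrite /F (_ : _ == _ = false) ?mulr0n ?subr0 //; lia.
  rewrite mulr1; apply: eq_bigr => i _; rewrite /F (_ : _ == _ = true); last by lia.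
  by rewrite mulr1n mulnA.
rewrite (@big_cat_nat _ _ _ (2 * M)) //=; last by lia.
rewrite -[X in eq_trunc _ _ X]mulr1; apply: eq_truncMl.
pose P i := (2 * M <= i < 2 * (2 * M))%N.
have := @eq_trunc_prod int N.+1 _ (index_iota (2 * M) (2 * (2 * M))) P F (fun=> 1).
rewrite big1_eq -big_nat; apply.
move=> i /andP[Mi _]; rewrite /F.
case: (_ == _); rewrite ?mulr0n ?subr0 // mulr1n.
by apply: eq_trunc_1BXn; lia.
Qed.

(** Taking (1+y)(1-y) = 1-y^2 at y = q^(2j+1) yields (q^2;q^4)_M, which up to truncation supplies
    the factors missing from [P2_prod M]; the full product splits by parity. *)
Lemma odd_even_P2_prod N M : (N <= 2 * M)%N -> eq_trunc N.+1
  (\prod_(0 <= j < M) (1 + 'X^((2 * j).+1)) * (P2_prod M * odd_prod M))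
  (even_prod M * odd_prod M).
Proof.
move=> NM; rewrite mulrCA.
have -> : \prod_(0 <= j < M) (1 + 'X^((2 * j).+1)) * odd_prod M =
    \prod_(0 <= j < M) (1 - 'X^((4 * j).+2)).
  rewrite -big_split /=; apply: eq_bigr => j _.
  have -> : ((4 * j).+2 = (2 * j).+1 + (2 * j).+1)%N by lia.
  by rewrite exprD; ring.
apply: eq_trunc_trans (eq_truncMl _ (prod_2mod4 NM)) _.
rewrite mulrC -big_split /= /even_prod /odd_prod [RHS in eq_trunc _ _ RHS]mulrC.
rewrite -(prod_nat_double (fun i => 1 - 'X^(i.+1))).
suff -> : \prod_(0 <= i < 2 * M) ((1 - 'X^(i.+1) *+ (i.+1 %% 4 == 2)%N) *
   (1 - 'X^(i.+1) *+ P2_part (i.+1, false))) =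
   \prod_(0 <= i < 2 * M) (1 - 'X^(i.+1)) :> {poly int} by [].
apply: eq_bigr => i _; rewrite /P2_part /=.
by case: (_ == _); rewrite !(mulr1n, mulr0n) subr0 ?mulr1 ?mul1r.
Qed.

Lemma P2_lt0 (x : int) : x < 0 -> P2 x = 0%N.
Proof. by case: x. Qed.

Lemma overpartition_P2_identity n :
  odd_overpartitions n =
  (\sum_(0 <= k < 2 * n.+1) P2 (n%:Z - (k * k.+1 %/ 2)%N%:Z)%R)%N.
Proof.
set M := n.+1.
have nM : (n <= 2 * M)%N by rewrite /M; lia.
have nM' : (n < 2 * M)%N by rewrite /M; lia.
pose T : {poly int} := \sum_(0 <= k < 2 * M) 'X^(k * k.+1 %/ 2).
have key : eq_trunc n.+1 (T * over_series P2_part n (2 * M))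
                         (over_series odd_part n (2 * M)).
  (* This multiplier clears all denominators: both sides become [even_prod M * odd_prod M]. *)
  apply: (@eq_trunc_mulI _ _ _ _ (odd_prod M * (P2_prod M * odd_prod M))).
    by rewrite !coef0M !coef0_prod ?mulr1 // => i _;
      rewrite coefB ?coefMn coefXn coef1 /= ?mul0rn subr0.
  have -> : T * over_series P2_part n (2 * M) *
      (odd_prod M * (P2_prod M * odd_prod M)) =
      (T * odd_prod M) * (over_series P2_part n (2 * M) * P2_prod M) * odd_prod M.
    by ring.
  rewrite [X in eq_trunc _ _ X]mulrA.
  apply: eq_trunc_trans (eq_truncM (eq_truncM (triangular_series nM') (P2_series n M))
    (erefl _)) _.
  rewrite mulr1; apply: esym.
  apply: eq_trunc_trans (eq_truncM (odd_overpartitions_series n M) (erefl _)) _.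
  exact: odd_even_P2_prod.
move/eq_truncP/(_ n (ltnSn n)): key.
rewrite coef_poly ltnSn -odd_overpartitionsE // /T mulr_suml coef_sum => key.
apply/eqP; rewrite -(eqr_nat int) -key natr_sum; apply/eqP/eq_bigr => k _.
(* When k(k+1)/2 > n the coefficient is 0, matching the value of [P2] at a negative integer. *)
rewrite coefXnM coef_poly; case: ltnP => kn.
  by rewrite P2_lt0 // subr_lt0 ltz_nat.
rewrite ltnS leq_subr subzn // -P2_natE //; lia.
Qed.

End Products.

Local Open Scope ring_scope.
Local Open Scope ereal_scope.

Theorem theorem3p8 (R : realType) (n : nat) (n_gt0 : (0 < n)%N) :
  (odd_overpartitions n)%:R%:E =
  \sum_(0 <= k <oo) (P2 (n%:Z - (k * k.+1 %/ 2)%N%:Z)%R)%:R%:E :> \bar R.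
Proof.
(* The tail vanishes, since k(k+1)/2 >= k > n for k >= 2(n+1). *)
rewrite (nneseries_split 0 (2 * n.+1)) => [|k _]; last by rewrite lee_fin ler0n.
rewrite eseries0 ?adde0 => [|k + _]; last first.
  rewrite add0n => nk.
  have kn : (n < k * k.+1 %/ 2)%N.
    have : (k <= k * k.+1 %/ 2)%N by rewrite leq_divRL // leq_mul2l; lia.
    by lia.
  by rewrite P2_lt0 // subr_lt0 ltz_nat.
by rewrite add0n sumEFin -natr_sum -overpartition_P2_identity.
Qed.
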